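(* Let $m,n\ge 1$ be integers, $\mu\in\mathbb{C}$, and let $W$ be the $\mathfrak{sl}_{m|n}(\mathbb{C})$-module (depending on $\mu$) defined in the context. (1) If $m\ge 2$, then $W$ is a highest weight module of $\mathfrak{sl}_{m|n}(\mathbb{C})$ with highest weight vector $1$, and the highest weight $\lambda$ is given by $(\lambda(h_1),\dots,\lambda(h_m),\lambda(h'_1),\dots,\lambda(h'_{n-1}))=(\mu,0,\dots,0)$. Moreover, $W$ is an irreducible module if and only if $\mu$ is not a nonnegative integer. (2) If $m=1$ and $n\ge 2$, then $W$ is a highest weight module of $\mathfrak{sl}_{1|n}(\mathbb{C})$ with highest weight vector $1$, and the highest weight $\lambda$ is given by $(\lambda(h_1),\lambda(h'_1),\dots,\lambda(h'_{n-1}))=(\mu,0,\dots,0)$. Moreover, $W$ is an irreducible module if and only if $\mu\notin\{0,1,\dots,n-1\}$.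
   Context: All vector spaces and algebras are over $\mathbb{C}$. $\mathfrak{gl}_{m|n}(\mathbb{C})$ is the general linear Lie superalgebra with matrix units $E_{i,j}$, $1\le i,j\le m+n$ (indices $1,\dots,m$ even, $m+1,\dots,m+n$ odd), and $\mathfrak{sl}_{m|n}(\mathbb{C})=[\mathfrak{gl}_{m|n}(\mathbb{C}),\mathfrak{gl}_{m|n}(\mathbb{C})]$. $W$ is the associative algebra generated by $x_2,\dots,x_m,y_1,\dots,y_n$ subject to $x_ix_j=x_jx_i$, $x_iy_k=y_kx_i$, $y_ky_l=-y_ly_k$ (so $W\cong\mathbb{C}[x_2,\dots,x_m]\otimes\bigwedge^*(\mathbb{C}y_1\oplus\cdots\oplus\mathbb{C}y_n)$), with $x_i$ even and $y_k$ odd. $\frac{\partial}{\partial x_i}$ (even) and $\frac{\partial}{\partial y_k}$ (odd) are the partial differential operators on $W$, with $[\frac{\partial}{\partial x_i},x_j]=\delta_{i,j}$ and $\frac{\partial}{\partial y_k}y_l+y_l\frac{\partial}{\partial y_k}=\delta_{k,l}$. $W$ is a $\mathfrak{gl}_{m|n}(\mathbb{C})$-module, hence by restriction an $\mathfrak{sl}_{m|n}(\mathbb{C})$-module, with $E_{i,j}$ acting as $e_{i,j}$, where for $i,j=2,\dots,m$ and $k,l=1,\dots,n$: $e_{1,1}=\mu-\sum_{s=2}^m x_s\frac{\partial}{\partial x_s}-\sum_{t=1}^n y_t\frac{\partial}{\partial y_t}$, $e_{i,1}=x_i$, $e_{m+k,1}=y_k$, $e_{1,i}=e_{1,1}\frac{\partial}{\partial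 x_i}$, $e_{1,m+k}=e_{1,1}\frac{\partial}{\partial y_k}$, $e_{i,j}=x_i\frac{\partial}{\partial x_j}$, $e_{i,m+k}=x_i\frac{\partial}{\partial y_k}$, $e_{m+k,i}=y_k\frac{\partial}{\partial x_i}$, $e_{m+k,m+l}=y_k\frac{\partial}{\partial y_l}$. The Cartan subalgebra $\mathfrak{h}'$ of $\mathfrak{sl}_{m|n}(\mathbb{C})$ is its subspace of diagonal matrices, with basis $h_i=E_{i,i}-E_{i+1,i+1}$ ($1\le i\le m-1$), $h_m=E_{m,m}+E_{m+1,m+1}$, $h'_j=E_{m+j,m+j}-E_{m+j+1,m+j+1}$ ($1\le j\le n-1$). Highest weight modules are taken with respect to the standard Borel subalgebra of upper triangular matrices: a highest weight vector is a weight vector that is killed by all strictly upper triangular elements and generates the module. *)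

(* Defs.v *)
From HB Require Import structures.
From mathcomp Require Import all_boot all_order all_algebra.
From mathcomp Require Import mpoly ring zify.
From mathcomp Require Import reals complex.
Set Implicit Arguments.
Unset Strict Implicit.
Unset Printing Implicit Defensive.
Import GRing.Theory.
Local Open Scope ring_scope.

(* The number of pairs (s, t), s in S, t in T, with t < s: the number of
   transpositions needed to sort the word y_S y_T. *)
Definition inversions n (S T : {set 'I_n}) : nat :=
  \sum_(s in S) \sum_(t in T) (t < s)%N.

Lemma inversionsUl n (S T U : {set 'I_n}) : [disjoint S & T] ->
  inversions (S :|: T) U = (inversions S U + inversions T U)%N.
Proof.
move=> dST; rewrite /inversions -bigU //.
by apply: eq_bigl => s; rewrite !inE.
Qed.

Lemma inversionsUr n (S T U : {set 'I_n}) : [disjoint T & U] ->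
  inversions S (T :|: U) = (inversions S T + inversions S U)%N.
Proof.
move=> dTU; rewrite /inversions -big_split /=.
apply: eq_bigr => s _; rewrite -bigU //.
by apply: eq_bigl => t; rewrite !inE.
Qed.

(* F[x_0, ..., x_(k-1)] (x) /\(y_0, ..., y_(n-1)).  The element w stands for
   \sum_S w S * y_S, where y_S is the product of the y_s, s in S, taken in
   increasing order. *)
Definition superpoly (F : fieldType) (k n : nat) : Type :=
  {ffun {set 'I_n} -> {mpoly F[k]}}.

Section Superpoly.

Variables (F : fieldType) (k n : nat).

HB.instance Definition _ := GRing.Lmodule.copy (superpoly F k n)
  {ffun {set 'I_n} -> {mpoly F[k]}}.

Local Notation W := (superpoly F k n).
Implicit Types (u v w : W) (S T U : {set 'I_n}).

Definition sp_one : W := [ffun S : {set 'I_n} => (S == set0)%:R].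

Definition sp_mul u v : W :=
  [ffun U : {set 'I_n} => \sum_(S : {set 'I_n} | S \subset U)
     (-1) ^+ inversions S (U :\: S) * u S * v (U :\: S)].

Lemma spD u v S : (u + v) S = u S + v S. Proof. exact: ffunE. Qed.
Lemma spZ a v S : (a *: v) S = a *: v S. Proof. exact: ffunE. Qed.

Lemma sp_mulA : associative sp_mul.
Proof.
move=> u v w; apply/ffunP => U; rewrite !ffunE; symmetry.
under eq_bigr do rewrite ffunE mulr_sumr mulr_suml.
rewrite (exchange_big_dep (fun T : {set 'I_n} => T \subset U)) /=; last first.
  by move=> S T sSU sTS; apply: subset_trans sSU.
apply: eq_bigr => T sTU; rewrite ffunE mulr_sumr.
rewrite (reindex_onto (fun V => T :|: V) (fun S => S :\: T)) /=; last first.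
  move=> S /andP[_ /setIidPr sTS]; rewrite -{1}sTS; exact: setID.
apply: eq_big => [V|V].
  rewrite subUset sTU subsetUl andbT /= subsetD; congr (_ && _).
  by rewrite setDUl setDv set0U; apply/eqP/setDidPl.
move=> /andP[/andP[sVU _] /eqP VE].
have dTV : [disjoint T & V].
  by rewrite -VE disjoint_sym disjoints_subset setDE subsetIr.
have sV : V \subset U :\: T.
  by rewrite subsetD disjoint_sym dTV (subset_trans (subsetUr T V) sVU).
have E3 : inversions T (U :\: T) =
    (inversions T V + inversions T ((U :\: T) :\: V))%N.
  rewrite -inversionsUr; last first.
    by rewrite disjoint_sym disjoints_subset setDE subsetIr.
  by congr inversions; rewrite -{1}(setID (U :\: T) V) (setIidPr sV).
rewrite VE -setDDl inversionsUl // E3 !exprD; ring.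
Qed.

Lemma sp_mul1w : left_id sp_one sp_mul.
Proof.
move=> w; apply/ffunP => U; rewrite ffunE (bigD1 set0) ?sub0set //= big1.
  by rewrite ffunE eqxx setD0 /inversions big_set0 !mul1r addr0.
by move=> S /andP[_ /negPf S0]; rewrite ffunE S0 mulr0 mul0r.
Qed.

Lemma sp_mulw1 : right_id sp_one sp_mul.
Proof.
move=> w; apply/ffunP => U; rewrite ffunE (bigD1 U) //= big1.
  rewrite ffunE setDv eqxx /inversions big1 ?mul1r ?mulr1 ?addr0 // => s _.
  by rewrite big_set0.
move=> S /andP[sSU neSU]; rewrite ffunE setD_eq0.
by rewrite [U \subset S](_ : _ = false) ?mulr0 //; apply: contraNF neSU => sUS;
  rewrite eqEsubset sSU.
Qed.

Lemma sp_mulDl : left_distributive sp_mul +%R.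
Proof.
move=> u v w; apply/ffunP => U; rewrite spD !ffunE -big_split /=.
by apply: eq_bigr => S _; rewrite spD mulrDr mulrDl.
Qed.

Lemma sp_mulDr : right_distributive sp_mul +%R.
Proof.
move=> u v w; apply/ffunP => U; rewrite spD !ffunE -big_split /=.
by apply: eq_bigr => S _; rewrite spD mulrDr.
Qed.

Lemma sp_one_neq0 : sp_one != 0.
Proof.
by apply/eqP => /ffunP /(_ set0) /eqP; rewrite !ffunE eqxx oner_eq0.
Qed.

HB.instance Definition _ := GRing.Zmodule_isNzRing.Build W
  sp_mulA sp_mul1w sp_mulw1 sp_mulDl sp_mulDr sp_one_neq0.

Lemma sp_scaleAl a u v : a *: (u * v) = (a *: u) * v.
Proof.
apply/ffunP => U; rewrite spZ !ffunE scaler_sumr.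
by apply: eq_bigr => S _; rewrite spZ -scalerAr -scalerAl.
Qed.

HB.instance Definition _ := GRing.Lmodule_isLalgebra.Build F W sp_scaleAl.

Lemma sp_scaleAr a u v : a *: (u * v) = u * (a *: v).
Proof.
apply/ffunP => U; rewrite spZ !ffunE scaler_sumr.
by apply: eq_bigr => S _; rewrite spZ -scalerAr.
Qed.

HB.instance Definition _ := GRing.Lalgebra_isAlgebra.Build F W sp_scaleAr.

Definition sp_x (s : 'I_k) : W := [ffun S : {set 'I_n} => if S == set0 then 'X_s else 0].
Definition sp_y (t : 'I_n) : W := [ffun S : {set 'I_n} => (S == [set t])%:R].

Definition sp_dx (s : 'I_k) (w : W) : W := [ffun S => (w S)^`M(s)].

Definition sp_dy (t : 'I_n) (w : W) : W :=
  [ffun S : {set 'I_n} => if t \in S then 0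
     else (-1) ^+ inversions [set t] S * w (t |: S)].

Definition sp_part (p : bool) (w : W) : W :=
  [ffun S : {set 'I_n} => if odd #|S| == p then w S else 0].

Lemma sp_xE s w S : (sp_x s * w) S = 'X_s * w S.
Proof.
rewrite ffunE (bigD1 set0) ?sub0set //= big1 ?addr0.
  by rewrite ffunE eqxx setD0 /inversions big_set0 mul1r.
by move=> T /andP[_ /negPf T0]; rewrite ffunE T0 mulr0 mul0r.
Qed.

Lemma sp_yE t w S : (sp_y t * w) S =
  if t \in S then (-1) ^+ inversions [set t] (S :\ t) * w (S :\ t) else 0.
Proof.
rewrite ffunE; case: ifPn => tS.
  rewrite (bigD1 [set t]) ?sub1set //= big1 ?addr0.
    by rewrite ffunE eqxx mulr1.
  by move=> T /andP[_ /negPf T0]; rewrite ffunE T0 mulr0 mul0r.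
rewrite big1 // => T sTS; rewrite ffunE; case: eqP => [ET|]; last first.
  by rewrite mulr0 mul0r.
by rewrite ET sub1set (negPf tS) in sTS.
Qed.

Lemma sp_xC s w : sp_x s * w = w * sp_x s.
Proof.
apply/ffunP => S; rewrite sp_xE ffunE (bigD1 S) //= big1 ?addr0.
  rewrite ffunE setDv eqxx /inversions big1 ?mul1r 1?mulrC // => t _.
  by rewrite big_set0.
move=> T /andP[sTS neTS]; rewrite ffunE setD_eq0.
by rewrite [S \subset T](_ : _ = false) ?mulr0 //; apply: contraNF neTS => sST;
  rewrite eqEsubset sTS.
Qed.

Lemma inversions1U (t s : 'I_n) S : s \notin S ->
  inversions [set t] (s |: S) = ((s < t) + inversions [set t] S)%N.
Proof.
by move=> sS; rewrite /inversions !big_set1 big_setU1.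
Qed.

Lemma inversions1D (t s : 'I_n) S : s \in S ->
  inversions [set t] S = ((s < t) + inversions [set t] (S :\ s))%N.
Proof. by move=> sS; rewrite -inversions1U ?setD1K // !inE eqxx. Qed.

Lemma sp_yy (s t : 'I_n) : sp_y s * sp_y t = - (sp_y t * sp_y s).
Proof.
wlog ltst : s t / (s < t)%N.
  case: (ltngtP s t) => [ltst|ltts|/ord_inj ->] Hw; first exact: Hw.
    by rewrite (Hw t s) ?opprK.
  apply/ffunP => S; rewrite [RHS]ffunE !sp_yE; case: ifP => // tS; last by rewrite oppr0.
  rewrite ffunE; have [ES|] := eqVneq (S :\ t) [set t]; last by rewrite mulr0 oppr0.
  by have := set11 t; rewrite -ES !inE eqxx.
apply/ffunP => S; rewrite [RHS]ffunE !sp_yE !ffunE.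
have neq : s != t by rewrite -val_eqE /= ltn_eqF.
have [->|neS] := eqVneq S [set s; t].
  have -> : [set s; t] :\ s = [set t].
    by apply/setP => r; rewrite !inE; case: eqVneq => // ->; rewrite (negPf neq).
  have -> : [set s; t] :\ t = [set s].
    by apply/setP => r; rewrite !inE orbC; case: eqVneq => // ->; rewrite eq_sym (negPf neq).
  rewrite !inE !eqxx orbT /inversions !big_set1 ltst ltnNge (ltnW ltst).
  by rewrite expr0 expr1 !mulr1 opprK.
have H (a b : 'I_n) : (a \in S) -> S :\ a = [set b] -> S = [set a; b].
  by move=> aS E; rewrite -(setD1K aS) E.
case: ifP => sS; case: ifP => tS; rewrite ?oppr0 //.
- have [/H E|_] := eqVneq (S :\ s); first by rewrite E // eqxx in neS.
  have [/H E|_] := eqVneq (S :\ t); first by rewrite E // setUC eqxx in neS.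
  by rewrite !mulr0 oppr0.
- have [/H E|_] := eqVneq (S :\ s); first by rewrite E // eqxx in neS.
  by rewrite mulr0.
have [/H E|_] := eqVneq (S :\ t); first by rewrite E // setUC eqxx in neS.
by rewrite mulr0 oppr0.
Qed.

Lemma sp_dx1 s : sp_dx s 1 = 0.
Proof.
apply/ffunP => S; rewrite !ffunE.
by rewrite -mpolyC_nat mderivC.
Qed.

Lemma sp_dy1 t : sp_dy t 1 = 0.
Proof.
apply/ffunP => S; rewrite !ffunE; case: ifP => // _.
have /negPf -> : t |: S != set0 by apply/set0Pn; exists t; rewrite setU11.
by rewrite mulr0.
Qed.

Lemma sp_dx_x s t w :
  sp_dx s (sp_x t * w) = sp_x t * sp_dx s w + (s == t)%:R *: w.
Proof.
apply/ffunP => S; rewrite spD spZ sp_xE ffunE sp_xE ffunE mderivM mderivX.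
rewrite mnm1E addrC eq_sym; congr (_ + _).
case: eqP => [->|_]; last by rewrite !scale0r mul0r.
by rewrite -{1}[U_(t)%MM]add0m addmK mpolyX0 !scale1r mul1r.
Qed.

Lemma sp_dx_y s t w : sp_dx s (sp_y t * w) = sp_y t * sp_dx s w.
Proof.
apply/ffunP => S; rewrite sp_yE ffunE sp_yE ffunE.
case: ifP => _; last by rewrite mderiv0.
by rewrite -signr_odd !mulr_sign; case: ifP; rewrite ?mderivN.
Qed.

Lemma sp_dy_x s t w : sp_dy t (sp_x s * w) = sp_x s * sp_dy t w.
Proof.
apply/ffunP => S; rewrite sp_xE [LHS]ffunE [sp_dy _ _ _]ffunE sp_xE.
by case: ifP; rewrite ?mulr0 // mulrCA.
Qed.

Lemma sp_dy_y s t w :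
  sp_dy s (sp_y t * w) + sp_y t * sp_dy s w = (s == t)%:R *: w.
Proof.
apply/ffunP => S.
rewrite spD spZ sp_yE [sp_dy _ (_ * _) _]ffunE [sp_dy _ _ _]ffunE sp_yE !inE.
have [->|neq] := eqVneq s t.
  rewrite scale1r; case: ifP => tS; rewrite ?addr0 ?add0r.
    by rewrite setD1K // signrMK.
  by rewrite setU1K ?tS // signrMK.
rewrite scale0r /=.
case: (boolP (s \in S)) => sS.
  by rewrite mulr0 add0r; case: ifP.
case: ifP => tS; last by rewrite mulr0 addr0.
have -> : (s |: S) :\ t = s |: (S :\ t).
  apply/setP => r; rewrite !inE; case: (eqVneq r s) => [->|//].
  by rewrite neq.
rewrite inversions1U ?inE ?(negPf sS) ?andbF // (inversions1D s tS).
rewrite !exprD.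
have -> : (s < t)%N = ~~ (t < s)%N.
  by case: ltngtP neq => // /ord_inj ->; rewrite eqxx.
by case: (t < s)%N; rewrite /= expr0 expr1; ring.
Qed.

End Superpoly.

Section GeneralLinear.

Variables (F : fieldType) (m n : nat).

Local Notation M := 'M[F]_(m + n).
Implicit Types (A B : M) (p q : bool).

Definition odd_index (i : 'I_(m + n)) : bool := (m <= i)%N.

(* The even (p = false) or odd (p = true) part of A in gl_(m|n). *)
Definition gl_part p A : M :=
  \matrix_(i, j) (if odd_index i (+) odd_index j == p then A i j else 0).

Definition sbracket A B : M :=
  \sum_(p : bool) \sum_(q : bool)
    (gl_part p A *m gl_part q B - (-1) ^+ (p && q) *: (gl_part q B *m gl_part p A)).

Definition matrix_units : seq M :=
  [seq delta_mx i j | i <- enum 'I_(m + n), j <- enum 'I_(m + n)].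

(* [gl_(m|n), gl_(m|n)], the span of all brackets: see sbracket_sl. *)
Definition sl : {vspace M} :=
  <<[seq sbracket A B | A <- matrix_units, B <- matrix_units]>>%VS.

Lemma gl_part_linear p : linear (gl_part p).
Proof.
move=> a A B; apply/matrixP => i j; rewrite !mxE.
by case: ifP => _; rewrite ?mulr0 ?addr0.
Qed.

Lemma sbracket_linearl B : linear (sbracket^~ B).
Proof.
move=> a A1 A2; rewrite /sbracket scaler_sumr -big_split /=.
apply: eq_bigr => p _; rewrite scaler_sumr -big_split /=.
apply: eq_bigr => q _; rewrite gl_part_linear mulmxDl mulmxDr -scalemxAl.
rewrite -scalemxAr scalerBr scalerDr opprD addrACA; congr (_ - _ + _).
by rewrite !scalerA mulrC.
Qed.

Lemma sbracket_linearr A : linear (sbracket A).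
Proof.
move=> a B1 B2; rewrite /sbracket scaler_sumr -big_split /=.
apply: eq_bigr => p _; rewrite scaler_sumr -big_split /=.
apply: eq_bigr => q _; rewrite gl_part_linear mulmxDl mulmxDr -scalemxAl.
rewrite -scalemxAr scalerBr scalerDr opprD addrACA; congr (_ - _ + _).
by rewrite !scalerA mulrC.
Qed.

HB.instance Definition _ A :=
  GRing.isLinear.Build F M M *:%R (sbracket A) (sbracket_linearr A).

Lemma sbracket_sl A B : sbracket A B \in sl.
Proof.
rewrite [B]matrix_sum_delta linear_sum rpred_sum //= => i _.
rewrite linear_sum rpred_sum //= => j _.
rewrite linearZ rpredZ //=; set D := delta_mx _ _.
pose f : {linear M -> M} := HB.pack (sbracket^~ D)
  (GRing.isLinear.Build F M M *:%R (sbracket^~ D) (sbracket_linearl D)).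
rewrite -[sbracket A D]/(f A) [A]matrix_sum_delta.
rewrite linear_sum rpred_sum // => k _; rewrite linear_sum rpred_sum // => l _.
rewrite linearZ rpredZ //= /f /= /D; apply: memv_span.
by apply: allpairs_f; apply: allpairs_f; rewrite mem_enum.
Qed.

Lemma gl_part_part p q A :
  gl_part p (gl_part q A) = if p == q then gl_part q A else 0.
Proof.
apply/matrixP => i j; rewrite !mxE.
by case: p q => [] []; rewrite ?mxE /=; case: (odd_index i (+) odd_index j).
Qed.

Lemma sbracket_homog p q A B : gl_part p A = A -> gl_part q B = B ->
  sbracket A B = A *m B - (-1) ^+ (p && q) *: (B *m A).
Proof.
move=> hA hB; rewrite /sbracket (bigD1 p) //= [X in _ + X]big1 ?addr0; last first.
  move=> p' /negPf np; apply: big1 => q' _.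
  by rewrite -hA gl_part_part np mul0mx mulmx0 scaler0 subrr.
rewrite (bigD1 q) //= [X in _ + X]big1 ?addr0 ?hA ?hB // => q' /negPf nq.
rewrite -[in gl_part q' B]hB gl_part_part nq.
by rewrite mul0mx mulmx0 scaler0 subrr.
Qed.

Lemma gl_part_delta i j :
  gl_part (odd_index i (+) odd_index j) (delta_mx i j) = delta_mx i j.
Proof.
apply/matrixP => a b; rewrite !mxE; case: andP => [[/eqP-> /eqP->]|_].
  by rewrite eqxx.
by case: ifP.
Qed.

(* The diagonal matrices in sl_(m|n). *)
Definition cartan : {vspace M} :=
  (sl :&: <<[seq delta_mx i i | i <- enum 'I_(m + n)]>>)%VS.

Lemma cartanE A : (A \in cartan) = (A \in sl) && is_diag_mx A.
Proof.
rewrite memv_cap; congr (_ && _); apply/idP/is_diag_mxP => [|dA].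
  move=> /(coord_span (X := in_tuple _)) -> i j neq; rewrite summxE big1 // => l _; rewrite mxE.
  have /mapP[a _ E] : [seq delta_mx i i | i <- enum 'I_(m + n)]`_l
      \in [seq (delta_mx i i : M) | i <- enum 'I_(m + n)].
    exact: mem_nth.
  rewrite E mxE; case: eqVneq => [<-|]; rewrite ?mulr0 //=.
  by rewrite eq_sym -val_eqE (negPf neq) mulr0.
rewrite [A]matrix_sum_delta rpred_sum // => i _.
rewrite (bigD1 i) //= big1 => [|j neq]; last by rewrite dA ?scale0r // eq_sym.
by rewrite addr0 rpredZ // memv_span //; apply/mapP; exists i; rewrite ?mem_enum.
Qed.

Definition strictly_upper A : Prop :=
  forall i j : 'I_(m + n), (j <= i)%N -> A i j = 0.

(* The matrix unit E_(i,j), with indices starting from 1; it is 0 when i or j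
   is not in 1, ..., m + n. *)
Definition unit_mx (i j : nat) : M :=
  \matrix_(a, b) ((a.+1 == i) && (b.+1 == j))%:R.

(* h_1, ..., h_m, h'_1, ..., h'_(n-1) (for m, n >= 1), as matrices and as
   elements of the Cartan subalgebra; vsproj does not change these matrices, see
   cartan_gens_val. *)
Definition cartan_gens_mx : seq M :=
  [seq unit_mx i i - unit_mx i.+1 i.+1 | i <- iota 1 m.-1] ++
  (unit_mx m m + unit_mx m.+1 m.+1) ::
  [seq unit_mx (m + j) (m + j) - unit_mx (m + j).+1 (m + j).+1 | j <- iota 1 n.-1].

Definition cartan_gens : seq (subvs_of cartan) :=
  [seq vsproj cartan h | h <- cartan_gens_mx].

Lemma unit_mx_cartan (i j : nat) :
  (0 < i <= m + n)%N -> (0 < j <= m + n)%N -> i != j ->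
  unit_mx i i - (-1) ^+ ((m < i)%N (+) (m < j)%N) *: unit_mx j j \in cartan.
Proof.
case: i => // i; case: j => // j /= ltim ltjm neq.
have uE (k : nat) (ltk : (k < m + n)%N) :
    unit_mx k.+1 k.+1 = delta_mx (Ordinal ltk) (Ordinal ltk).
  by apply/matrixP => a b; rewrite !mxE !eqSS.
rewrite cartanE !uE; set a := Ordinal ltim; set b := Ordinal ltjm.
apply/andP; split; last first.
  apply/is_diag_mxP => c d ncd; rewrite !mxE.
  have H x : (c == x) && (d == x) = false.
    by apply: contraNF ncd => /andP[/eqP-> /eqP->].
  by rewrite !H mulr0 subrr.
have := sbracket_sl (delta_mx a b) (delta_mx b a).
rewrite (sbracket_homog (gl_part_delta a b) (gl_part_delta b a)).
by rewrite !mul_delta_mx addbC andbb.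
Qed.

Lemma cartan_gens_val : (0 < m)%N -> (0 < n)%N ->
  [seq vsval h | h <- cartan_gens] = cartan_gens_mx.
Proof.
move=> m_gt0 n_gt0; rewrite /cartan_gens -map_comp -[RHS]map_id.
apply/eq_in_map => h; rewrite mem_cat inE /= => hP; apply: vsprojK.
case/or3P: hP => [/mapP[k]|/eqP->|/mapP[j]].
- rewrite mem_iota => lei ->.
  have := @unit_mx_cartan k k.+1.
  have -> : (m < k)%N = false by lia.
  have -> : (m < k.+1)%N = false by lia.
  by rewrite scale1r; apply; lia.
- have := @unit_mx_cartan m m.+1.
  by rewrite ltnn ltnSn /= expr1 scaleN1r opprK; apply; lia.
rewrite mem_iota => lei ->.
have := @unit_mx_cartan (m + j) (m + j).+1.
have -> : (m < m + j)%N by lia.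
have -> : (m < (m + j).+1)%N by lia.
by rewrite scale1r; apply; lia.
Qed.

End GeneralLinear.

(* Modules over sl_(m|n): V is a superspace with parity projections part, and rho
   is the action, a function on gl_(m|n) of which only the restriction to
   sl_(m|n) matters. *)
Section Modules.

Variables (F : fieldType) (m n : nat) (V : lmodType F).
Variables (part : bool -> V -> V) (rho : 'M[F]_(m + n) -> V -> V).
Implicit Types (A B : 'M[F]_(m + n)) (u v : V) (p q : bool) (U : V -> Prop).

Record sl_module : Prop := SlModule {
  part_linear : forall p, linear (part p);
  part_part : forall p q v, part p (part q v) = if p == q then part p v else 0;
  part_sum : forall v, part false v + part true v = v;
  act_linear : forall A, A \in sl F m n -> linear (rho A);
  act_linearl : forall a A B v, A \in sl F m n -> B \in sl F m n ->
    rho (a *: A + B) v = a *: rho A v + rho B v;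
  act_part : forall p q A v, A \in sl F m n -> gl_part p A = A ->
    part q v = v -> part (p (+) q) (rho A v) = rho A v;
  act_bracket : forall p q A B v, A \in sl F m n -> B \in sl F m n ->
    gl_part p A = A -> gl_part q B = B ->
    rho (sbracket A B) v
      = rho A (rho B v) - (-1) ^+ (p && q) *: rho B (rho A v)
}.

Definition submodule U : Prop :=
  [/\ U 0, forall a u v, U u -> U v -> U (a *: u + v)
    & forall A v, A \in sl F m n -> U v -> U (rho A v)].

Definition graded U : Prop := forall p v, U v -> U (part p v).

Definition trivial_subspace U : Prop :=
  (forall v, U v -> v = 0) \/ (forall v, U v).

Definition irreducible_module : Prop :=
  [/\ sl_module, exists v, v != 0
    & forall U, submodule U -> trivial_subspace U].

Definition graded_irreducible_module : Prop :=
  [/\ sl_module, exists v, v != 0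
    & forall U, submodule U -> graded U -> trivial_subspace U].

Definition weight_vector (lam : {scalar subvs_of (cartan F m n)}) v : Prop :=
  v != 0 /\ forall H : subvs_of (cartan F m n), rho (vsval H) v = lam H *: v.

Definition generates v : Prop :=
  forall U, submodule U -> U v -> forall w, U w.

Definition highest_weight_vector lam v : Prop :=
  [/\ weight_vector lam v,
      forall A, A \in sl F m n -> strictly_upper A -> rho A v = 0
    & generates v].

Definition highest_weight_module lam v : Prop :=
  sl_module /\ highest_weight_vector lam v.

End Modules.

Section Representation.

Variables (F : fieldType) (m n : nat) (mu : F).

(* x_2, ..., x_m are the variables sp_x s, s : 'I_m.-1, with x_i = sp_x (i - 2);
   y_1, ..., y_n are the sp_y t, t : 'I_n, with y_k = sp_y (k - 1). *)
Local Notation W := (superpoly F m.-1 n).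

Inductive slot := First | Even of 'I_m.-1 | Odd of 'I_n.

Definition slot_of (a : 'I_(m + n)) : slot :=
  match split a with
  | inl i => if [pick s : 'I_m.-1 | s.+1 == i :> nat] is Some s then Even s
             else First
  | inr t => Odd t
  end.

Definition e11 (w : W) : W :=
  mu *: w - \sum_(s < m.-1) sp_x F n s * sp_dx s w
          - \sum_(t < n) sp_y F m.-1 t * sp_dy t w.

Definition e_ (a b : 'I_(m + n)) (w : W) : W :=
  match slot_of a, slot_of b with
  | First, First => e11 w
  | Even i, First => sp_x F n i * w
  | Odd k, First => sp_y F m.-1 k * w
  | First, Even j => e11 (sp_dx j w)
  | First, Odd l => e11 (sp_dy l w)
  | Even i, Even j => sp_x F n i * sp_dx j w
  | Even i, Odd l => sp_x F n i * sp_dy l w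
  | Odd k, Even j => sp_y F m.-1 k * sp_dx j w
  | Odd k, Odd l => sp_y F m.-1 k * sp_dy l w
  end.

Definition act (A : 'M[F]_(m + n)) (w : W) : W :=
  \sum_i \sum_j A i j *: e_ i j w.

End Representation.

(* Main.v *)
From HB Require Import structures.
Require Import Defs.
From mathcomp Require Import all_boot all_order all_algebra.
From mathcomp Require Import mpoly ring zify.
From mathcomp Require Import boolp reals complex.
Import GRing.Theory.
Local Open Scope ring_scope.
Set Implicit Arguments.
Unset Strict Implicit.
Unset Printing Implicit Defensive.

(* Write z_a for the even and odd variables, d_a for their derivations and e for
   mu - (Euler operator).  The super Lie bracket relations follow from the
   (super)commutation of the z_a, of the d_a, and from [d_a, z_b} = delta_(a,b),
   [e, z_a] = - z_a, [e, d_a] = d_a.  The variables z_a come from the lowering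
   operators E_(a,1), so 1 generates W.  The raising operators e d_b are
   multiplied by mu - d on the image of the component of degree d + 1.  If this
   factor vanishes for some d for which W has a component of degree d + 1, then
   the elements of lowest degree at least d + 1 form a proper submodule.
   Otherwise some e d_b does not kill a given nonconstant element and lowers its
   degree, so that every nonzero submodule contains 1. *)

(** * Super bracket relations of abstract oscillator operators *)

Section OscillatorBracket.

Variables (F : fieldType) (V : lmodType F) (I : eqType) (parity : pred I).
Variables (z d : I -> {linear V -> V}) (e : {linear V -> V}).

(** The operator of E_(i,j), where [None] is the index 1 and [Some a] the index of z_a: the left
    factor is e or z_a, the right factor, acting first, is the identity or d_b. *)
Definition eop (i j : option I) v : V :=
  match i, j with
  | None, None => e v
  | Some a, None => z a v
  | None, Some b => e (d b v)
  | Some a, Some b => z a (d b v)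
  end.

Hypothesis zz : forall a b v,
  z a (z b v) = (-1) ^+ (parity a && parity b) *: z b (z a v).
Hypothesis dd : forall a b v,
  d a (d b v) = (-1) ^+ (parity a && parity b) *: d b (d a v).
Hypothesis dz : forall a b v,
  d a (z b v) = (-1) ^+ (parity a && parity b) *: z b (d a v) + (a == b)%:R *: v.
Hypothesis ez : forall a v, e (z a v) = z a (e v) - z a v.
Hypothesis de : forall a v, d a (e v) = e (d a v) - d a v.

Local Notation op := (oapp parity false).

(* Evaluating at a linear functional phi turns the identity into one between
   scalars, where ring applies. *)
Lemma eop_bracket_functional (phi : V -> F) (i j k l : option I) v
    (s := (-1) ^+ ((op i (+) op j) && (op k (+) op l))) :
  (forall u w, phi (u + w) = phi u + phi w) -> (forall u, phi (- u) = - phi u) ->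
  (forall x u, phi (x *: u) = x * phi u) ->
  phi (eop i j (eop k l v) - s *: eop k l (eop i j v)) =
    phi ((j == k)%:R *: eop i l v - s *: ((l == i)%:R *: eop k j v)).
Proof.
move=> phiD phiN phiZ; have SE (a b : I) : (Some a == Some b) = (a == b) by [].
rewrite {}/s; case: i j k l => [a|] [b|] [x|] [y|] /=.
all: rewrite ?(de, dz, ez, linearD, linearN, linearZ, SE) /=.
(* All derivations have been moved to the right of the z's. The two products now differ only in the
   order of z_a, z_x and of d_b, d_y, which is made the same. *)
all: try rewrite (zz a x).
all: try rewrite (dd b y).
all: rewrite ?(linearN, linearZ) ?(phiD, phiN, phiZ) /= ?(phiD, phiN, phiZ).
all: try case: (parity a).
all: try case: (parity b).
all: try case: (parity x).
all: try case: (parity y).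
all: rewrite /= ?expr0 ?expr1.
all: ring.
Qed.

End OscillatorBracket.

(** * Multiplications, derivations and the Euler operator on superpolynomials *)

Section Operators.

Variables (F : fieldType) (k n : nat) (mu : F).

Local Notation W := (superpoly F k n).
Local Notation var := ('I_k + 'I_n)%type.
Implicit Types (a b c d : var) (u v w : W).

Definition parity a : bool := if a is inr _ then true else false.

Definition mulv a w : W :=
  match a with inl s => sp_x F n s * w | inr t => sp_y F k t * w end.

Definition dv a w : W :=
  match a with inl s => sp_dx s w | inr t => sp_dy t w end.

Lemma spN w S : (- w) S = - w S. Proof. exact: ffunE. Qed.

Lemma mulv_linear a : linear (mulv a).
Proof. by move=> c v w; case: a => s; rewrite /mulv mulrDr scalerAr. Qed.

HB.instance Definition _ a := GRing.isLinear.Build F W W *:%R (mulv a) (mulv_linear a).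

Lemma dv_linear a : linear (dv a).
Proof.
move=> c v w; case: a => s; apply/ffunP => S; rewrite spD spZ !ffunE ?(spD, spZ) ?linearP //.
by case: ifP => _; rewrite ?scaler0 ?addr0 // mulrDr scalerAr.
Qed.

HB.instance Definition _ a := GRing.isLinear.Build F W W *:%R (dv a) (dv_linear a).

Lemma mulv_mulv a b w :
  mulv a (mulv b w) = (-1) ^+ (parity a && parity b) *: mulv b (mulv a w).
Proof.
case: a b => [s|t] [s'|t'] /=; rewrite ?scale1r !mulrA.
- by rewrite sp_xC.
- by rewrite sp_xC.
- by rewrite -sp_xC.
- by rewrite sp_yy expr1 scaleN1r mulNr.
Qed.

Lemma dv_dv a b w :
  dv a (dv b w) = (-1) ^+ (parity a && parity b) *: dv b (dv a w).
Proof.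
case: a b => [s|t] [s'|t'] /=; rewrite ?scale1r; apply/ffunP => S; rewrite ?spZ !ffunE.
- by rewrite mderiv_comm.
- by case: ifP => _; rewrite ?raddf0 // -signr_odd !mulr_sign; case: ifP; rewrite ?raddfN.
- by case: ifP => _; rewrite ?raddf0 // -signr_odd !mulr_sign; case: ifP; rewrite ?raddfN.
rewrite !inE; have [<-|ne] := eqVneq t t'.
  by rewrite /=; case: ifP => _; rewrite ?mulr0 scaler0.
rewrite /=.
case: (boolP (t \in S)) => tS; case: (boolP (t' \in S)) => t'S; rewrite ?mulr0 ?scaler0 //.
(* Here S contains neither t nor t'. Each order of insertion has one extra term in its sign, t < t'
   in one and t' < t in the other; exactly one of these holds, whence the minus sign. *)
rewrite !inversions1U // !exprD setUCA expr1 scaleN1r.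
have -> : (t' < t)%N = ~~ (t < t')%N by case: ltngtP ne => // /ord_inj ->; rewrite eqxx.
by case: (t < t')%N; rewrite /= expr0 expr1; ring.
Qed.

Lemma dv_mulv a b w :
  dv a (mulv b w) =
    (-1) ^+ (parity a && parity b) *: mulv b (dv a w) + (a == b)%:R *: w.
Proof.
case: a b => [s|t] [s'|t'] /=.
- by rewrite scale1r sp_dx_x.
- by rewrite scale1r sp_dx_y scale0r addr0.
- by rewrite scale1r sp_dy_x scale0r addr0.
rewrite scaleN1r; apply: (addIr (sp_y F k t' * sp_dy t w)).
by rewrite sp_dy_y addrAC addNr add0r.
Qed.

Definition euler w : W := \sum_(a : var) mulv a (dv a w).

Lemma euler_linear : linear euler.
Proof.
move=> c v w; rewrite /euler scaler_sumr -big_split /=.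
by apply: eq_bigr => a _; rewrite !linearP.
Qed.

HB.instance Definition _ := GRing.isLinear.Build F W W *:%R euler euler_linear.

(** Moving z_a to the left through z_b d_b yields the same sign twice, so signs cancel; the
    Kronecker terms of [dv_mulv] sum to z_a. The lemma [dv_euler] is the same computation with
    d_a. *)
Lemma euler_mulv a w : euler (mulv a w) = mulv a (euler w) + mulv a w.
Proof.
rewrite /euler linear_sum /=.
have E : mulv a w = \sum_b (b == a)%:R *: mulv b w.
  by rewrite (bigD1 a) //= eqxx scale1r big1 ?addr0 // => b /negPf->; rewrite scale0r.
rewrite [X in _ = _ + X]E -big_split /=; apply: eq_bigr => b _.
rewrite dv_mulv linearD !linearZ /= (mulv_mulv b a) scalerA -expr2.
by rewrite sqrr_sign scale1r.
Qed.

Lemma dv_euler a w : dv a (euler w) = euler (dv a w) + dv a w.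
Proof.
rewrite /euler linear_sum /=.
have E : dv a w = \sum_b (a == b)%:R *: dv b w.
  rewrite (bigD1 a) //= eqxx scale1r big1 ?addr0 // => b.
  by rewrite eq_sym => /negPf->; rewrite scale0r.
rewrite [X in _ = _ + X]E -big_split /=; apply: eq_bigr => b _.
rewrite dv_mulv; congr (_ + _).
rewrite (dv_dv a b) linearZ /= scalerA -expr2.
by rewrite sqrr_sign scale1r.
Qed.

(** The operator e of the abstract bracket computation; [e_E] identifies it with [e11]. *)
Definition weight1 w : W := mu *: w - euler w.

Lemma weight1_linear : linear weight1.
Proof.
move=> c v w; rewrite /weight1 euler_linear scalerBr scalerDr !scalerA mulrC.
by rewrite opprD addrACA.
Qed.

HB.instance Definition _ := GRing.isLinear.Build F W W *:%R weight1 weight1_linear.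

Lemma weight1_mulv a w : weight1 (mulv a w) = mulv a (weight1 w) - mulv a w.
Proof. by rewrite /weight1 euler_mulv linearB linearZ /= opprD addrA. Qed.

Lemma dv_weight1 a w : dv a (weight1 w) = weight1 (dv a w) - dv a w.
Proof. by rewrite /weight1 linearB linearZ /= dv_euler opprD addrA. Qed.

(** Coefficients are linear functionals that separate the elements of W. This turns
    [eop_bracket_functional] into an identity in W. *)
Lemma sp_ext u v :
  (forall phi : W -> F, (forall u v, phi (u + v) = phi u + phi v) ->
     (forall u, phi (- u) = - phi u) -> (forall x u, phi (x *: u) = x * phi u) ->
     phi u = phi v) ->
  u = v.
Proof.
move=> eq_uv; apply/ffunP => S; apply/mpolyP => x.
by apply: (eq_uv (fun w => (w S)@_x)) => *;
  rewrite ?(spD, spZ, spN) ?(mcoeffD, mcoeffZ, mcoeffN).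
Qed.

Definition eop_sp :=
  eop (fun a => mulv a : {linear W -> W}) (fun a => dv a : {linear W -> W}) weight1.

Local Notation op := (oapp parity false).

Lemma eop_sp_linear i j : linear (eop_sp i j).
Proof.
by move=> x v w; case: i j => [a|] [b|];
  rewrite /eop_sp /= ?(dv_linear, weight1_linear, mulv_linear).
Qed.

HB.instance Definition _ i j :=
  GRing.isLinear.Build F W W *:%R (eop_sp i j) (eop_sp_linear i j).

Lemma eop_sp_bracket i j i' j' w (s := (-1) ^+ ((op i (+) op j) && (op i' (+) op j'))) :
  eop_sp i j (eop_sp i' j' w) - s *: eop_sp i' j' (eop_sp i j w) =
    (j == i')%:R *: eop_sp i j' w - s *: ((j' == i)%:R *: eop_sp i' j w).
Proof.
apply: sp_ext => phi phiD phiN phiZ.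
apply: eop_bracket_functional phiD phiN phiZ.
- exact: mulv_mulv.
- exact: dv_dv.
- exact: dv_mulv.
- exact: weight1_mulv.
- exact: dv_weight1.
Qed.

End Operators.

(** * The action of matrices and its compatibility with the bracket *)

Section Action.

Variables (F : fieldType) (m n : nat) (mu : F).

Local Notation W := (superpoly F m.-1 n).
Local Notation var := ('I_m.-1 + 'I_n)%type.
Local Notation index := 'I_(m + n).
Local Notation op := (oapp (@parity m.-1 n) false).
Implicit Types (a b c d : index) (A B : 'M[F]_(m + n)) (u v w : W) (p q : bool).

Definition var_of a : option var :=
  match slot_of a with First => None | Even s => Some (inl s) | Odd t => Some (inr t) end.

Lemma var_ofP a :
  match var_of a with
  | None => a = 0%N :> nat /\ (0 < m)%N
  | Some (inl s) => a = s.+1 :> nat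
  | Some (inr t) => a = (m + t)%N :> nat
  end.
Proof.
rewrite /var_of /slot_of; case: (split_ordP a) => [i ->|t ->] /=; last by [].
case: pickP => [s /eqP <-|no_s] //=.
have lt_im := ltn_ord i; case: (posnP i) => [i0|i_gt0]; first by split=> //; lia.
have lt_pi : (i.-1 < m.-1)%N by lia.
by have := no_s (Ordinal lt_pi); rewrite /= prednK // eqxx.
Qed.

(** By [var_ofP], an index is recovered from its variable. This makes the Kronecker deltas of matrix
    units agree with those of the variables. *)
Lemma var_of_inj : injective var_of.
Proof.
move=> a b eq_ab; apply: val_inj; have := var_ofP a; have := var_ofP b; rewrite eq_ab /=.
by case: (var_of b) => [[s|t]|] => [->|->|[-> _]] => [->|->|[->]].
Qed.

Lemma odd_indexE a : odd_index a = op (var_of a).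
Proof.
rewrite /odd_index; have := var_ofP a; case: (var_of a) => [[s|t]|] /=
  => [->|->|[-> m_gt0]].
- by have := ltn_ord s; lia.
- by rewrite leq_addr.
- by rewrite leqNgt m_gt0.
Qed.

Lemma e_E a b w : e_ mu a b w = eop_sp mu (var_of a) (var_of b) w.
Proof.
have e11E v : e11 mu v = weight1 mu v.
  by rewrite /e11 /weight1 /euler big_sumType /= opprD addrA.
by rewrite /e_ /var_of /eop_sp; case: (slot_of a) (slot_of b) => [|s|t] [|s'|t'] /=.
Qed.

Lemma e_linear a b : linear (e_ mu a b).
Proof. by move=> x v w; rewrite !e_E linearP. Qed.

HB.instance Definition _ a b :=
  GRing.isLinear.Build F W W *:%R (e_ mu a b) (e_linear a b).

Lemma e_bracket a b c d w
    (s := (-1) ^+ ((odd_index a (+) odd_index b) && (odd_index c (+) odd_index d))) :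
  e_ mu a b (e_ mu c d w) - s *: e_ mu c d (e_ mu a b w) =
    (b == c)%:R *: e_ mu a d w - s *: ((d == a)%:R *: e_ mu c b w).
Proof. by rewrite {}/s !e_E !odd_indexE eop_sp_bracket !(inj_eq var_of_inj). Qed.

Lemma act_linear A : linear (act mu A).
Proof.
move=> x v w; rewrite /act scaler_sumr -big_split /=; apply: eq_bigr => a _.
rewrite scaler_sumr -big_split /=; apply: eq_bigr => b _.
by rewrite linearP scalerDr !scalerA mulrC.
Qed.

HB.instance Definition _ A := GRing.isLinear.Build F W W *:%R (act mu A) (act_linear A).

Lemma act_linearl x A B w : act mu (x *: A + B) w = x *: act mu A w + act mu B w.
Proof.
rewrite /act scaler_sumr -big_split /=; apply: eq_bigr => a _.
rewrite scaler_sumr -big_split /=; apply: eq_bigr => b _.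
by rewrite !mxE scalerDl scalerA.
Qed.

Lemma act_delta a b w : act mu (delta_mx a b) w = e_ mu a b w.
Proof.
rewrite /act (bigD1 a) //= (bigD1 b) //= mxE !eqxx scale1r !big1 ?addr0 //.
  by move=> c /negPf ne; apply: big1 => d _; rewrite mxE ne scale0r.
by move=> c /negPf ne; rewrite mxE eqxx ne scale0r.
Qed.

Lemma gl_part_eq0 p A a b :
  gl_part p A = A -> odd_index a (+) odd_index b != p -> A a b = 0.
Proof. by move=> <- /negPf ne; rewrite mxE ne. Qed.

(** The Kronecker delta is left unevaluated to give the sum the shape of the one in [act_act]; the
    two can then be compared term by term. *)
Lemma act_mulmx A B w :
  act mu (A *m B) w = \sum_a \sum_b \sum_c \sum_d
    (A a b * B c d) *: ((b == c)%:R *: e_ mu a d w).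
Proof.
apply: eq_bigr => a _.
transitivity (\sum_b \sum_d (A a b * B b d) *: e_ mu a d w).
  by rewrite exchange_big /=; apply: eq_bigr => d _; rewrite mxE scaler_suml.
apply: eq_bigr => b _; rewrite [RHS](bigD1 b) //= [X in _ + X]big1 ?addr0.
  by apply: eq_bigr => d _; rewrite eqxx scale1r.
move=> c ne; apply: big1 => d _.
by rewrite eq_sym (negPf ne) scale0r scaler0.
Qed.

Lemma act_act A B w :
  act mu A (act mu B w) = \sum_a \sum_b \sum_c \sum_d
    (A a b * B c d) *: e_ mu a b (e_ mu c d w).
Proof.
apply: eq_bigr => a _; apply: eq_bigr => b _.
rewrite /act linear_sum scaler_sumr; apply: eq_bigr => c _.
rewrite linear_sum scaler_sumr; apply: eq_bigr => d _.
by rewrite linearZ scalerA.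
Qed.

(** Renames the summation indices in the product BA to match those in AB. *)
Lemma exchange_quad (G : index -> index -> index -> index -> W) :
  \sum_a \sum_b \sum_c \sum_d G a b c d = \sum_c \sum_d \sum_a \sum_b G a b c d.
Proof.
under eq_bigr => a _ do rewrite exchange_big /=.
rewrite exchange_big /=; apply: eq_bigr => c _.
under eq_bigr => a _ do rewrite exchange_big /=.
by rewrite exchange_big.
Qed.

Lemma act_bracket p q A B w : gl_part p A = A -> gl_part q B = B ->
  act mu (sbracket A B) w
    = act mu A (act mu B w) - (-1) ^+ (p && q) *: act mu B (act mu A w).
Proof.
move=> hA hB; rewrite (sbracket_homog hA hB) -scaleNr addrC act_linearl addrC scaleNr.
rewrite !act_mulmx !act_act.
rewrite [X in _ - _ *: X = _]exchange_quad [X in _ = _ - _ *: X]exchange_quad.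
rewrite !scaler_sumr -!sumrB; apply: eq_bigr => a _.
rewrite !scaler_sumr -!sumrB; apply: eq_bigr => b _.
rewrite !scaler_sumr -!sumrB; apply: eq_bigr => c _.
rewrite !scaler_sumr -!sumrB; apply: eq_bigr => d _.
(* Entries of the wrong parity vanish, so [e_bracket] is needed only where its sign is the global
   sign (-1) ^+ (p && q). *)
have [Aab|/(gl_part_eq0 hA) ->] := eqVneq (odd_index a (+) odd_index b) p; last first.
  by rewrite !(mul0r, mulr0, scale0r, scaler0).
have [Bcd|/(gl_part_eq0 hB) ->] := eqVneq (odd_index c (+) odd_index d) q; last first.
  by rewrite !(mul0r, mulr0, scale0r, scaler0).
have /(congr1 (fun v => (A a b * B c d) *: v)) := e_bracket a b c d w.
rewrite Aab Bcd !scalerBr !scalerA ![B c d * A a b]mulrC ![(-1) ^+ _ * _]mulrC.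
by move=> ->.
Qed.

End Action.

(** * Parity, total degree and monomials *)

Section Degree.

Variables (F : fieldType) (k n : nat).

Local Notation W := (superpoly F k n).
Local Notation var := ('I_k + 'I_n)%type.
Local Notation op := (oapp (@parity k n) false).
Implicit Types (a b : var) (u v w : W) (p q : bool) (S T : {set 'I_n}) (x y : 'X_{1..k}).

Lemma sp_part_linear p : linear (@sp_part F k n p).
Proof.
move=> c v w; apply/ffunP => S; rewrite spD spZ !ffunE.
by case: ifP => _; rewrite ?(spD, spZ) // scaler0 addr0.
Qed.

HB.instance Definition _ p :=
  GRing.isLinear.Build F W W *:%R (@sp_part F k n p) (sp_part_linear p).

Lemma sp_part_part p q w : sp_part p (sp_part q w) = if p == q then sp_part p w else 0.
Proof.
case: eqVneq => [->|ne]; apply/ffunP => S; rewrite !ffunE; first by case: eqP.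
by case: eqP => // ->; rewrite (negPf ne).
Qed.

Lemma sp_part_sum w : sp_part false w + sp_part true w = w.
Proof. by apply/ffunP => S; rewrite spD !ffunE; case: odd; rewrite ?addr0 ?add0r. Qed.

Lemma sp_part_mulv p a w : sp_part p (mulv a w) = mulv a (sp_part (parity a (+) p) w).
Proof.
apply/ffunP => S; rewrite ffunE; case: a => [s|t] /=.
  by rewrite !sp_xE ffunE; case: ifP; rewrite ?mulr0.
rewrite !sp_yE; case: (boolP (t \in S)) => tS; last by rewrite if_same.
by rewrite ffunE (cardsD1 t S) tS oddD /=; case: odd; case: p; rewrite /= ?mulr0.
Qed.

Lemma sp_part_dv p a w : sp_part p (dv a w) = dv a (sp_part (parity a (+) p) w).
Proof.
apply/ffunP => S; rewrite ffunE; case: a => [s|t] /=; rewrite !ffunE.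
  by case: ifP; rewrite ?linear0.
case: (boolP (t \in S)) => tS; first by rewrite if_same.
by rewrite cardsU1 tS oddD /=; case: odd; case: p; rewrite /= ?mulr0.
Qed.

Lemma sp_part_weight1 mu p w : sp_part p (weight1 mu w) = weight1 mu (sp_part p w).
Proof.
rewrite /weight1 linearB linearZ; congr (_ - _); rewrite /euler linear_sum.
by apply: eq_bigr => a _ /=; rewrite sp_part_mulv sp_part_dv addbA addbb.
Qed.

Lemma sp_part_eop mu p i j w :
  sp_part p (eop_sp mu i j w) = eop_sp mu i j (sp_part (op i (+) op j (+) p) w).
Proof.
by case: i j => [a|] [b|]; rewrite /eop_sp /= ?(sp_part_weight1, sp_part_mulv, sp_part_dv)
  ?(addbF, addFb) // addbA [parity b (+) _]addbC.
Qed.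

(** Subtraction of multi-indices is truncated, hence the separate case x s = 0. *)
Lemma mcoeffXM s (f : {mpoly F[k]}) x :
  ('X_s * f)@_x = if x s == 0%N then 0 else f@_(x - U_(s)).
Proof.
rewrite mulrC; have [x0|x_neq0] := eqVneq; last first.
  by rewrite -{1}(@submK _ U_(s) x) ?lep1mP // addmC mcoeffMX.
apply/eqP; rewrite mcoeff_eq0 (perm_mem (msuppMX _ _)).
by apply: contra_eqN x0 => /mapP[y _ ->]; rewrite mnmDE mnm1E eqxx.
Qed.

(** The degree of a monomial when even and odd variables all have degree 1. *)
Definition tdeg S x := (mdeg x + #|S|)%N.

Lemma mdeg_subU s x : x s != 0%N -> (mdeg (x - U_(s))).+1 = mdeg x.
Proof. by move=> xs; rewrite -{2}(@submK _ U_(s) x) ?lep1mP // mdegD mdeg1 addn1. Qed.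

(** That multiplication by a variable raises degrees by one is stated through supports, as is its
    counterpart for derivations below. No homogeneous components are needed. *)
Lemma coef_mulv_neq0 a w S x : (mulv a w S)@_x != 0 ->
  exists T y, (w T)@_y != 0 /\ (tdeg T y).+1 = tdeg S x.
Proof.
rewrite /tdeg; case: a => [s|t] /=.
  rewrite sp_xE mcoeffXM; case: ifPn => [|xs]; first by rewrite eqxx.
  by exists S, (x - U_(s))%MM; split=> //; rewrite -(mdeg_subU xs).
rewrite sp_yE; case: ifPn => [tS|]; last by rewrite mcoeff0 eqxx.
rewrite -signr_odd mulr_sign (fun_if (mcoeff x)) mcoeffN => cf.
exists (S :\ t), x; split; last by rewrite (cardsD1 t S) tS addnS.
by move: cf; case: ifP; rewrite ?oppr_eq0.
Qed.

Lemma coef_dv_neq0 a w S x : (dv a w S)@_x != 0 ->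
  exists T y, (w T)@_y != 0 /\ tdeg T y = (tdeg S x).+1.
Proof.
rewrite /tdeg; case: a => [s|t] /=; rewrite ffunE.
  rewrite mcoeff_deriv => cf; exists S, (x + U_(s))%MM.
  split; last by rewrite mdegD mdeg1 addn1.
  by apply: contraNneq cf => ->; rewrite mul0rn.
case: ifPn => [|tS]; first by rewrite mcoeff0 eqxx.
rewrite -signr_odd mulr_sign (fun_if (mcoeff x)) mcoeffN => cf.
exists (t |: S), x; split; last by rewrite cardsU1 tS addnS.
by move: cf; case: ifP; rewrite ?oppr_eq0.
Qed.

Lemma sp_sum (J : Type) (r : seq J) (G : J -> W) S :
  (\sum_(i <- r) G i) S = \sum_(i <- r) G i S.
Proof. by elim/big_rec2: _ => [|i y1 y2 _ <-]; rewrite (spD, ffunE). Qed.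

(** On a monomial, x_s d_s acts by the exponent of x_s, and y_t d_t by 1 or 0 according to whether
    y_t occurs; these eigenvalues add up to the degree. *)
Lemma coef_euler w S x : (euler w S)@_x = (tdeg S x)%:R * (w S)@_x.
Proof.
rewrite /euler sp_sum linear_sum big_sumType /=.
rewrite /tdeg mdegE -sum1_card natrD !natr_sum mulrDl !mulr_suml; congr (_ + _).
  apply: eq_bigr => s _; rewrite sp_xE ffunE mcoeffXM.
  have [->|xs] := eqVneq; first by rewrite mul0r.
  rewrite mcoeff_deriv submK ?lep1mP // mnmBE mnm1E eqxx subn1 prednK ?lt0n //.
  by rewrite mulr_natl.
rewrite [RHS]big_mkcond; apply: eq_bigr => t _; rewrite sp_yE.
case: ifP => tS; last by rewrite mcoeff0.
by rewrite ffunE !inE eqxx /= setD1K // signrMK mul1r.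
Qed.

Lemma coef_weight1 mu w S x :
  (weight1 mu w S)@_x = (mu - (tdeg S x)%:R) * (w S)@_x.
Proof. by rewrite /weight1 spD spN spZ mcoeffB mcoeffZ coef_euler mulrBl. Qed.

Definition monom S x : W := [ffun T : {set 'I_n} => if T == S then 'X_[x] else 0].

Lemma coef_monom S x T y : (monom S x T)@_y = ((T == S) && (x == y))%:R.
Proof. by rewrite ffunE; case: ifP; rewrite ?mcoeff0 ?mcoeffX. Qed.

Lemma coef_one S x : ((1 : W) S)@_x = ((S == set0) && (x == 0%MM))%:R.
Proof. by rewrite ffunE; case: eqP; rewrite ?mcoeff0 ?mcoeff1. Qed.

Lemma sum_monom w : w = \sum_S \sum_(x <- msupp (w S)) (w S)@_x *: monom S x.
Proof.
apply/ffunP => T; rewrite sp_sum (bigD1 T) //= [X in _ + X]big1 ?addr0 => [|S ne].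
  by rewrite sp_sum {1}[w T]mpolyE; apply: eq_bigr => x _; rewrite spZ ffunE eqxx.
by rewrite sp_sum big1 // => x _; rewrite spZ ffunE eq_sym (negPf ne) scaler0.
Qed.

Lemma tdeg_neq0 S x : tdeg S x != 0%N -> (exists t, t \in S) \/ (exists s, x s != 0%N).
Proof.
rewrite /tdeg addn_eq0 negb_and mdeg_eq0 cards_eq0 orbC => /orP[/set0Pn|]; first by left.
move=> x0; right; apply/existsP; apply: contraNT x0; rewrite negb_exists => /forallP x0.
by apply/eqP/mnmP => s; rewrite mnm0E; have := x0 s; rewrite negbK => /eqP.
Qed.

(** By induction on the degree, every monomial arises from 1, up to sign, by multiplying by one
    variable at a time; monomials span W. *)
Lemma mulv_closed (U : W -> Prop) :
  U 0 -> (forall c u v, U u -> U v -> U (c *: u + v)) ->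
  (forall a u, U u -> U (mulv a u)) -> U 1 -> forall w, U w.
Proof.
move=> U0 UP UM U1.
have UZ c u : U u -> U (c *: u) by move=> Uu; rewrite -[_ *: _]addr0; apply: UP.
have UD u v : U u -> U v -> U (u + v) by move=> Uu Uv; rewrite -[u]scale1r; apply: UP.
suff UX S x : U (monom S x).
  by move=> w; rewrite [w]sum_monom; elim/big_ind: _ => // S _;
    elim/big_ind: _ => // x _; apply: UZ.
have [d] := ubnP (tdeg S x); elim: d S x => // d IHd S x; rewrite ltnS => le_d.
have [d0|/tdeg_neq0[[t tS]|[s xs]]] := eqVneq (tdeg S x) 0%N.
- suff -> : monom S x = 1 by [].
  apply/ffunP => T; rewrite !ffunE; move/eqP: d0.
  rewrite /tdeg addn_eq0 mdeg_eq0 cards_eq0 => /andP[/eqP-> /eqP->].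
  by rewrite mpolyX0; case: eqP.
(* The sign comes from moving y_t past the smaller factors of y_S to its sorted place. *)
- have -> : monom S x =
      (-1) ^+ inversions [set t] (S :\ t) *: mulv (inr t) (monom (S :\ t) x).
    apply/ffunP => T; rewrite spZ /= sp_yE !ffunE.
    case: (boolP (t \in T)) => tT; last first.
      by rewrite scaler0; case: eqP => // ET; rewrite ET tS in tT.
    rewrite (_ : (T :\ t == S :\ t) = (T == S)); last first.
      by apply/eqP/eqP => [E|->//]; rewrite -(setD1K tT) -(setD1K tS) E.
    case: eqP => [->|_]; last by rewrite mulr0 scaler0.
    (* One sign is a scalar in F, the other a polynomial; both are reduced to the same boolean. *)
    by rewrite -(signr_odd F) -(signr_odd {mpoly F[k]}) mulr_sign scaler_sign;
      case: odd; rewrite ?opprK.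
  apply/UZ/UM/IHd; move: le_d; rewrite /tdeg (cardsD1 t S) tS; lia.
have -> : monom S x = mulv (inl s) (monom S (x - U_(s))).
  apply/ffunP => T; rewrite /= sp_xE !ffunE; case: eqP => _; last by rewrite mulr0.
  by rewrite -mpolyXD addmC submK // lep1mP.
by apply/UM/IHd; move: le_d; rewrite /tdeg -(mdeg_subU xs).
Qed.

(** A monomial of positive degree contains a variable. Deriving along it multiplies the coefficient
    by a sign or by a positive exponent, which is invertible in characteristic 0. *)
Lemma dv_eq0_coef w : [pchar F] =i pred0 -> (forall a, dv a w = 0) ->
  forall S x, tdeg S x != 0%N -> (w S)@_x = 0.
Proof.
move=> charF dw0 S x /tdeg_neq0[[t tS]|[s xs]].
  have /ffunP/(_ (S :\ t)) := dw0 (inr t); rewrite /= !ffunE !inE eqxx /= setD1K //.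
  by move/(congr1 (fun f => (-1) ^+ inversions [set t] (S :\ t) * f));
    rewrite signrMK mulr0 => ->; rewrite mcoeff0.
have /ffunP/(_ S) := dw0 (inl s); rewrite /= !ffunE => /(congr1 (mcoeff (x - U_(s))%MM)).
rewrite mcoeff0 mcoeff_deriv submK ?lep1mP // mnmBE mnm1E eqxx subn1 prednK ?lt0n //.
move/eqP; rewrite -mulr_natl mulf_eq0 => /orP[|/eqP //].
by rewrite (proj1 (pcharf0P F) charF) (negPf xs).
Qed.

End Degree.

(** * Highest weight, submodules and irreducibility *)

Section Structure.

Variables (F : fieldType) (m n : nat) (mu : F).
Hypothesis m_gt0 : (0 < m)%N.

Local Notation k := m.-1.
Local Notation W := (superpoly F k n).
Local Notation var := ('I_k + 'I_n)%type.
Local Notation index := 'I_(m + n).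
Local Notation part := (@sp_part F k n).
Local Notation rho := (@act F m n mu).
Implicit Types (a b : var) (u v w : W) (p q : bool) (S T : {set 'I_n}) (x y : 'X_{1..k}).

Lemma sl_module_superpoly : sl_module part rho.
Proof.
split=> //.
- exact: sp_part_linear.
- exact: sp_part_part.
- exact: sp_part_sum.
- by move=> A _; apply: act_linear.
- by move=> c A B v _ _; apply: act_linearl.
- move=> p q A v _ hA hv; rewrite /act linear_sum; apply: eq_bigr => a _.
  rewrite linear_sum; apply: eq_bigr => b _; rewrite linearZ /=.
  have [<-|/(gl_part_eq0 hA) ->] := eqVneq (odd_index a (+) odd_index b) p; last first.
    by rewrite !scale0r.
  by rewrite e_E sp_part_eop -!odd_indexE addbA addbb hv.
by move=> p q A B v _ _; apply: act_bracket.
Qed.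

(** For i different from j, E_(i,j) = [E_(i,i), E_(i,j)]. Hence submodules over sl are stable under
    all the raising and lowering operators. *)
Lemma delta_mx_sl (i j : index) : i != j -> delta_mx i j \in sl F m n.
Proof.
move=> ne; have := sbracket_sl (delta_mx i i : 'M[F]_(m + n)) (delta_mx i j).
rewrite (sbracket_homog (gl_part_delta F i i) (gl_part_delta F i j)) addbb.
by rewrite mul_delta_mx mul_delta_mx_0 1?eq_sym // scaler0 subr0.
Qed.

Lemma var_of_surj (o : option var) : exists i : index, var_of i = o.
Proof.
have [i def_i] : exists i : index, i = (match o with
    None => 0 | Some (inl s) => s.+1 | Some (inr t) => m + t end)%N :> nat.
  suff lt : (match o with
      None => 0 | Some (inl s) => s.+1 | Some (inr t) => m + t end < m + n)%N.
    by exists (Ordinal lt).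
  by case: o => [[[s ?]|[t ?]]|] /=; lia.
exists i; have := var_ofP i; rewrite def_i.
case: o {def_i} (var_of i) => [[s|t]|] [[s'|t']|] //=.
- by case=> /ord_inj ->.
- by have := ltn_ord s; lia.
- by case.
- by have := ltn_ord s'; lia.
- by move/addnI/ord_inj ->.
- by case; lia.
- by lia.
Qed.

Lemma submodule_mulv U a u : submodule rho U -> U u -> U (mulv a u).
Proof.
case=> _ _ Uact Uu.
have [i def_i] := var_of_surj (Some a); have [j def_j] := var_of_surj None.
have /delta_mx_sl/Uact/(_ Uu) : i != j by apply/eqP => E; rewrite E def_j in def_i.
by rewrite act_delta e_E def_i def_j.
Qed.

Lemma submodule_weight1_dv U a u : submodule rho U -> U u -> U (weight1 mu (dv a u)).
Proof.
case=> _ _ Uact Uu.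
have [i def_i] := var_of_surj None; have [j def_j] := var_of_surj (Some a).
have /delta_mx_sl/Uact/(_ Uu) : i != j by apply/eqP => E; rewrite E def_j in def_i.
by rewrite act_delta e_E def_i def_j.
Qed.

Lemma generates1 : generates rho (1 : W).
Proof.
move=> U subU U1 w; apply: mulv_closed U1 w; case: (subU) => // U0 UP _.
by move=> a u; apply: submodule_mulv.
Qed.

Lemma dv1 a : dv a (1 : W) = 0.
Proof. by case: a => s; [apply: sp_dx1|apply: sp_dy1]. Qed.

Lemma weight1_1 : weight1 mu (1 : W) = mu *: 1.
Proof. by rewrite /weight1 /euler big1 ?subr0 // => a _; rewrite dv1 linear0. Qed.

Lemma e_1 (i j : index) : var_of j != None -> e_ mu i j (1 : W) = 0.
Proof.
by rewrite e_E; case: (var_of i) (var_of j) => [a|] [b|] //= _;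
  rewrite /eop_sp /= dv1 !linear0.
Qed.

(** Used with i the first index: among the diagonal matrix units only E_(1,1) acts on 1 by a
    possibly nonzero scalar, namely mu. *)
Definition hw_fun (i : index) (H : subvs_of (cartan F m n)) : F := mu * vsval H i i.

Lemma hw_fun_linear i : scalar (hw_fun i).
Proof. by move=> c A B; rewrite /hw_fun linearP !mxE mulrDr mulrCA. Qed.

HB.instance Definition _ i :=
  GRing.isLinear.Build F (subvs_of (cartan F m n)) F *%R (hw_fun i) (hw_fun_linear i).

Lemma highest_weight_superpoly (i : index) : var_of i = None ->
  highest_weight_module part rho (hw_fun i) 1.
Proof.
move=> def_i; split; first exact: sl_module_superpoly.
split; last exact: generates1.
- split=> [|H]; first exact: oner_neq0.
  have := subvsP H; rewrite cartanE => /andP[_ /is_diag_mxP diagH].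
  rewrite /act (bigD1 i) //= (bigD1 i) //= !big1 ?addr0.
  + by rewrite e_E def_i /eop_sp /= weight1_1 scalerA mulrC.
  + move=> j ne; apply: big1 => l _; have [->|ne'] := eqVneq l j.
      by rewrite e_1 ?scaler0 // -def_i (inj_eq (@var_of_inj m n)).
    by rewrite diagH ?scale0r // eq_sym.
  + by move=> j ne; rewrite diagH ?scale0r // eq_sym.
move=> A _ upA; apply: big1 => j _; apply: big1 => l _.
(* Columns other than the first kill 1, as they begin by differentiating; the first column of a
   strictly upper triangular matrix is zero. *)
have [l0|ne] := eqVneq (var_of l) None; last by rewrite e_1 ?scaler0.
by have := var_ofP l; rewrite l0 => -[l00 _]; rewrite upA ?scale0r // l00.
Qed.

Lemma map_eq0_nseq (A : eqType) (f : A -> F) (s : seq A) :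
  (forall z, z \in s -> f z = 0) -> map f s = nseq (size s) 0.
Proof.
move=> f0; elim: s f0 => //= z s IHs f0; rewrite f0 ?mem_head // IHs // => z' zs.
by apply: f0; rewrite inE zs orbT.
Qed.

Lemma hw_fun_gens (i : index) : i = 0%N :> nat -> (0 < n)%N ->
  [seq hw_fun i h | h <- cartan_gens F m n] = mu :: nseq (m + n - 2) 0.
Proof.
move=> i0 n_gt0; pose f (A : 'M[F]_(m + n)) := mu * A i i.
transitivity (map f (map vsval (cartan_gens F m n))).
  by rewrite -[RHS]map_comp.
rewrite cartan_gens_val // /cartan_gens_mx map_cat /= -!map_comp.
have fE j : unit_mx F m n j j i i = (j == 1%N)%:R by rewrite mxE i0 andbb eq_sym.
have f0 j : (1 < j)%N -> f (unit_mx F m n j j - unit_mx F m n j.+1 j.+1) = 0.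
  move=> j_gt1; rewrite /f mxE [X in _ + X]mxE !fE eqSS.
  by rewrite (gtn_eqF j_gt1) (gtn_eqF (ltnW j_gt1)) subrr mulr0.
have -> : (m + n - 2)%N = (m.-1 + n.-1)%N by lia.
rewrite (map_eq0_nseq (s := iota 1 n.-1)) ?size_iota; last first.
  by move=> j; rewrite mem_iota => hj; apply: f0; lia.
(* If m = 1, the leading generator is h_m = E_(1,1) + E_(2,2). Otherwise it is E_(1,1) - E_(2,2),
   and h_m has zero (1,1) entry. *)
case: (boolP (m == 1%N)) => [m1|m_neq1].
  have -> : m.-1 = 0%N by lia.
  by rewrite /= /f mxE !fE m1 eqSS (gtn_eqF m_gt0) addr0 mulr1.
have -> : m.-1 = m.-2.+1 by lia.
rewrite /= {1}/f mxE [X in _ + X]mxE !fE /= subr0 mulr1; congr (_ :: _).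
rewrite (map_eq0_nseq (s := iota 2 _)) ?size_iota; last first.
  by move=> j; rewrite mem_iota => hj; apply: f0; lia.
rewrite /f mxE !fE (negPf m_neq1) eqSS (gtn_eqF m_gt0) addr0 mulr0.
by rewrite -[0 :: nseq n.-1 0]/(nseq n.-1.+1 0) -nseqD addnS.
Qed.

(** The d-th power of the ideal generated by all the variables. *)
Definition low d w := forall S x, (tdeg S x < d)%N -> (w S)@_x = 0.

Lemma lowP d c u v : low d u -> low d v -> low d (c *: u + v).
Proof.
by move=> lu lv S x lt; rewrite spD spZ mcoeffD mcoeffZ lu // lv // mulr0 addr0.
Qed.

Lemma low_le d d' u : (d' <= d)%N -> low d u -> low d' u.
Proof. by move=> le_d lu S x lt; apply: lu; apply: leq_trans le_d. Qed.

Lemma low_mulv d a u : low d u -> low d.+1 (mulv a u).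
Proof.
move=> lu S x lt; apply/eqP/negP => /negP/coef_mulv_neq0[T [y [/eqP neq]]] eq_d.
by apply: neq; apply: lu; rewrite -eq_d in lt.
Qed.

Lemma low_dv d a u : low d u -> low d.-1 (dv a u).
Proof.
move=> lu S x lt; apply/eqP/negP => /negP/coef_dv_neq0[T [y [/eqP neq]]] eq_d.
by apply: neq; apply: lu; rewrite eq_d; lia.
Qed.

Lemma low_weight1 d u : low d u -> low d (weight1 mu u).
Proof. by move=> lu S x lt; rewrite coef_weight1 lu // mulr0. Qed.

Lemma low_submodule d : mu = d%:R -> submodule rho (low d.+1).
Proof.
move=> def_mu.
have low0 : low d.+1 0 by move=> S x _; rewrite ffunE mcoeff0.
split=> // [c u v|A v _ lv]; first exact: lowP.
have lowZ c u : low d.+1 u -> low d.+1 (c *: u).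
  by move=> lu; rewrite -[_ *: _]addr0; apply: lowP.
have lowD u w : low d.+1 u -> low d.+1 w -> low d.+1 (u + w).
  by move=> lu lw; rewrite -[u]scale1r; apply: lowP.
rewrite /act; elim/big_ind: _ => // i _; elim/big_ind: _ => // j _; apply: lowZ.
rewrite e_E /eop_sp; case: (var_of i) (var_of j) => [a|] [b|] /=.
- exact/low_mulv/(low_dv (d := d.+1)).
- exact: low_le (leqnSn _) (low_mulv a lv).
(* Only e d_b can leave the space, through a component of degree exactly d, and there e acts by mu -
   d = 0. *)
- move=> S x; rewrite ltnS leq_eqVlt coef_weight1 => /orP[/eqP->|lt].
    by rewrite def_mu subrr mul0r.
  by rewrite (low_dv b lv) // mulr0.
exact: low_weight1.
Qed.

Lemma low_graded d : graded part (low d).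
Proof. by move=> p v lv S x lt; rewrite ffunE; case: ifP => _; rewrite ?mcoeff0 ?lv. Qed.

(** The subspace contains the given monomial of degree d + 1 and does not contain 1. *)
Lemma low_nontrivial d S x : tdeg S x = d.+1 -> ~ trivial_subspace (low d.+1).
Proof.
move=> deg_x [low_eq0|low_all].
  have /low_eq0/ffunP/(_ S)/(congr1 (mcoeff x)) : low d.+1 (monom F S x).
    move=> T y; rewrite coef_monom; case: andP => // -[/eqP-> /eqP<-].
    by rewrite deg_x ltnn.
  by rewrite coef_monom !eqxx ffunE mcoeff0 => /eqP; rewrite oner_eq0.
have := low_all 1 set0 0%MM; rewrite /tdeg cards0 mdeg0 coef_one !eqxx => /(_ isT)/eqP.
by rewrite oner_eq0.
Qed.

Hypothesis charF : [pchar F] =i pred0.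

(** The second condition says that W is nonzero in degree d + 1; it matters when m = 1, where
    degrees stop at n. *)
Definition singular := exists d, mu = d%:R /\ exists S x, tdeg S x = d.+1.

(** Induction on a strict bound for the degrees in u. If some d_a u is nonzero, e d_a u is a nonzero
    element of U with a smaller bound; otherwise u is a nonzero constant. *)
Lemma submodule_one U u : ~ singular -> submodule rho U -> U u -> u != 0 -> U 1.
Proof.
move=> nsing subU.
have [d] : exists d, forall S x, (u S)@_x != 0 -> (tdeg S x < d)%N.
  (* [msize] strictly bounds the degree in the even variables, and n bounds the number of odd
     ones. *)
  exists (\sum_S msize (u S) + n)%N => S x.
  rewrite -mcoeff_msupp => /msize_mdeg_lt lt_x; rewrite /tdeg.
  have := max_card S; rewrite card_ord => le_n.
  by rewrite (bigD1 S) //= -addnA -addSn leq_add // (leq_trans le_n) ?leq_addl.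
elim: d u => [|d IHd] u le_d Uu u_neq0.
  case/eqP: u_neq0; apply/ffunP => S; apply/mpolyP => x; rewrite [in RHS]ffunE mcoeff0.
  by apply/eqP/negP => /negP/le_d.
have [dv0|] := boolP [forall a, dv a u == 0].
  pose c := (u set0)@_0%MM.
  have def_u : u = c *: 1.
    apply/ffunP => S; apply/mpolyP => x; rewrite spZ mcoeffZ coef_one.
    have [|neq0] := eqVneq (tdeg S x) 0%N.
      rewrite /tdeg => /eqP; rewrite addn_eq0 mdeg_eq0 cards_eq0 => /andP[/eqP-> /eqP->].
      by rewrite !eqxx mulr1.
    rewrite (dv_eq0_coef charF) // => [|a]; last exact/eqP/(forallP dv0).
    case: andP => [[/eqP S0 /eqP x0]|_]; last by rewrite mulr0.
    by rewrite /tdeg S0 x0 mdeg0 cards0 in neq0.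
  have c_neq0 : c != 0 by apply: contraNneq u_neq0 => c0; rewrite def_u c0 scale0r.
  case: subU => U0 UP _; have := UP c^-1 u 0 Uu U0.
  by rewrite addr0 {1}def_u scalerA mulVf // scale1r.
rewrite negb_forall => /existsP[a dv_neq0].
(* A monomial of degree d in d_a u comes from one of degree d + 1 in u, so mu = d would make mu
   singular. Thus e kills no coefficient of d_a u. *)
have nz S x : (dv a u S)@_x != 0 -> (weight1 mu (dv a u) S)@_x != 0.
  move=> neq0; rewrite coef_weight1 mulf_neq0 // subr_eq0; apply/eqP => def_mu.
  have [T [y [_ deg_y]]] := coef_dv_neq0 neq0.
  by apply: nsing; exists (tdeg S x); split; last exists T, y.
apply: (IHd (weight1 mu (dv a u))).
- move=> S x; rewrite coef_weight1 mulf_eq0 negb_or.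
  move=> /andP[_ /coef_dv_neq0[T [y [neq0 deg_y]]]].
  by rewrite -ltnS -deg_y le_d.
- exact: submodule_weight1_dv.
apply: contraNneq dv_neq0 => v0; apply/eqP/ffunP => S; apply/mpolyP => x.
rewrite [in RHS]ffunE mcoeff0; apply/eqP; apply: contraT => /nz.
by rewrite v0 ffunE mcoeff0 eqxx.
Qed.

Lemma submodule_trivial U : ~ singular -> submodule rho U -> trivial_subspace U.
Proof.
(* U is an arbitrary predicate, so excluded middle decides whether it has a nonzero element. *)
move=> nsing subU; have [[u [Uu u_neq0]]|U0] := EM (exists u, U u /\ u != 0).
  by right; apply: generates1 => //; apply: submodule_one Uu u_neq0.
by left=> v Uv; apply/eqP/negP => /negP v_neq0; apply: U0; exists v.
Qed.

Lemma irreducible_superpoly : irreducible_module part rho <-> ~ singular.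
Proof.
split=> [[_ _ irr] [d [def_mu [S [x deg_x]]]]|nsing].
  exact: (low_nontrivial deg_x) (irr _ (low_submodule def_mu)).
split; [exact: sl_module_superpoly|by exists 1; apply: oner_neq0|].
by move=> U; apply: submodule_trivial.
Qed.

(** The proper submodule found for singular mu is graded, so both notions of irreducibility single
    out the same parameters. *)
Lemma graded_irreducible_superpoly : graded_irreducible_module part rho <-> ~ singular.
Proof.
split=> [[_ _ irr] [d [def_mu [S [x deg_x]]]]|nsing].
  exact: (low_nontrivial deg_x) (irr _ (low_submodule def_mu) (@low_graded _)).
split; [exact: sl_module_superpoly|by exists 1; apply: oner_neq0|].
by move=> U subU _; apply: submodule_trivial.
Qed.

End Structure.

(** * Explicit description of the singular parameters *)

Section SingularParameters.

Variables (F : fieldType) (n : nat) (mu : F).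

Lemma singular_gt1 m : (1 < m)%N -> singular m n mu <-> exists d : nat, mu = d%:R.
Proof.
(* For m > 1 there is an even variable, and its power of exponent d + 1 has the required degree for
   every d. *)
move=> m_gt1; split=> [[d [def_mu _]]|[d def_mu]]; first by exists d.
have s_lt : (0 < m.-1)%N by lia.
exists d; split=> //; exists set0, (U_(Ordinal s_lt) *+ d.+1)%MM.
by rewrite /tdeg cards0 mdegMn mdeg1 mul1n addn0.
Qed.

(** Without even variables the degree of a monomial is the size of S, so degree d + 1 occurs exactly
    when d + 1 is at most n. *)
Lemma singular_eq1 : (0 < n)%N ->
  singular 1 n mu <-> exists2 d : nat, (d <= n - 1)%N & mu = d%:R.
Proof.
move=> n_gt0; split=> [[d [def_mu [S [x]]]]|[d le_dn def_mu]].
  rewrite /tdeg mdegE big_ord0 add0n => card_S; exists d => //.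
  by have := max_card S; rewrite card_ord card_S; lia.
have le_dn' : (d.+1 <= n)%N by lia.
(* The monomial is the product of the first d + 1 odd variables. *)
exists d; split=> //; exists [set widen_ord le_dn' i | i : 'I_d.+1], 0%MM.
rewrite /tdeg mdeg0 add0n card_imset ?card_ord // => i j /(congr1 val) /=.
exact: ord_inj.
Qed.

End SingularParameters.

(** * Highest weight on the Cartan generators and the irreducibility criteria *)

Lemma highest_weight_gens (F : fieldType) (m n : nat) (mu : F) : (0 < m)%N -> (0 < n)%N ->
  exists2 lam : {scalar subvs_of (cartan F m n)},
    highest_weight_module (@sp_part F m.-1 n) (@act F m n mu) lam 1
    & [seq lam h | h <- cartan_gens F m n] = mu :: nseq (m + n - 2) 0.
Proof.
move=> m_gt0 n_gt0; have [i def_i] := var_of_surj m_gt0 (None : option ('I_m.-1 + 'I_n)).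
exists (hw_fun mu i); first exact: highest_weight_superpoly.
by apply: hw_fun_gens => //; have := var_ofP i; rewrite def_i => -[].
Qed.

Theorem theorem2p4 (R : realType) (m n : nat) (mu : R[i]) :
  (1 <= m)%N -> (1 <= n)%N ->
  ((2 <= m)%N ->
    [/\ exists2 lam : {scalar subvs_of (cartan R[i] m n)},
          highest_weight_module (@sp_part R[i] m.-1 n) (@act R[i] m n mu) lam 1
          & [seq lam h | h <- cartan_gens R[i] m n] = mu :: nseq (m + n - 2) 0,
        irreducible_module (@sp_part R[i] m.-1 n) (@act R[i] m n mu)
          <-> ~ (exists k : nat, mu = k%:R)
      & graded_irreducible_module (@sp_part R[i] m.-1 n) (@act R[i] m n mu)
          <-> ~ (exists k : nat, mu = k%:R)])
  /\
  (m = 1%N -> (2 <= n)%N ->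
    [/\ exists2 lam : {scalar subvs_of (cartan R[i] m n)},
          highest_weight_module (@sp_part R[i] m.-1 n) (@act R[i] m n mu) lam 1
          & [seq lam h | h <- cartan_gens R[i] m n] = mu :: nseq (m + n - 2) 0,
        irreducible_module (@sp_part R[i] m.-1 n) (@act R[i] m n mu)
          <-> ~ (exists2 k : nat, (k <= n - 1)%N & mu = k%:R)
      & graded_irreducible_module (@sp_part R[i] m.-1 n) (@act R[i] m n mu)
          <-> ~ (exists2 k : nat, (k <= n - 1)%N & mu = k%:R)]).
Proof.
move=> m_gt0 n_gt0; have charC : [pchar R[i]] =i pred0 by apply: Num.Theory.pchar_num.
have irr := irreducible_superpoly n mu m_gt0 charC.
have girr := graded_irreducible_superpoly n mu m_gt0 charC.
have hw := highest_weight_gens mu m_gt0 n_gt0.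
split=> [m_gt1|m1 _].
  by split=> //; rewrite -(singular_gt1 n mu m_gt1).
by subst m; split=> //; rewrite -(singular_eq1 mu n_gt0).
Qed.
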